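(* Let $k>d\geq 2$ be integers. The competitive ratio of the \textsc{Ranking} algorithm for online bipartite matching on $(k,d)$-bounded graphs is at most $$1-\frac{(1-1/d)^k\cdot(d-1)}{k+d-1}.$$
   Context: Online bipartite matching: offline servers $S$, online requests $R$ arriving one at a time in adversarial order; on arrival of $r$ its neighbors are revealed and the algorithm irrevocably matches $r$ to an unmatched neighbor or leaves it unmatched. Competitive ratio on a class of instances: infimum of $\mathbb{E}[\mathsf{ALG}]/\mathsf{OPT}$, with $\mathsf{ALG}$ the produced matching size and $\mathsf{OPT}$ the maximum matching size. A bipartite graph is $(k,d)$-bounded if every server has degree at least $k$ and every request has degree at most $d$. \textsc{Ranking}: each server independently draws a rank uniformly from $[0,1]$; each arriving request is matched to its unmatched neighbor of smallest rank, if any. *)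

(* Defs.v *)
From HB Require Import structures.
From mathcomp Require Import all_boot all_order all_algebra.
From mathcomp Require Import all_classical all_reals all_analysis.

Set Implicit Arguments.
Unset Strict Implicit.
Unset Printing Implicit Defensive.

Import Order.TTheory GRing.Theory Num.Theory.

Local Open Scope ring_scope.

Record bigraph := Bigraph {
  server : finType;
  request : finType;
  adj : server -> request -> bool }.

Definition kd_bounded (k d : nat) (G : bigraph) : Prop :=
  (forall s : server G, (k <= #|[set r | adj s r]%SET|)%N) /\
  (forall r : request G, (#|[set s | adj s r]%SET| <= d)%N).

Definition is_matching (G : bigraph) (M : {set server G * request G}) : bool :=
  [forall e in M, adj e.1 e.2] &&
  [forall e in M, forall f in M,
     ((e.1 == f.1) || (e.2 == f.2)) ==> (e == f)].

Definition OPT (G : bigraph) : nat :=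
  \max_(M : {set server G * request G} | is_matching M) #|M|.

Record instance := Instance {
  graph : bigraph;
  arrival : seq (request graph);
  arrivalP : perm_eq arrival (enum (request graph)) }.

Section Ranking.
Context {R : realType} (G : bigraph) (rank : server G -> R).

Definition unmatched_nbrs (M : {set server G * request G}) (r : request G) :
    {set server G} :=
  [set s | adj s r & [forall r', (s, r') \notin M]]%SET.

(* [s0] only witnesses that the set is nonempty. When several servers attain
   the minimum the choice is that of [arg min]; under [ranks] this happens
   with probability 0. *)
Definition ranking_step (M : {set server G * request G}) (r : request G) :
    {set server G * request G} :=
  if [pick s in unmatched_nbrs M r] is Some s0
  then ([arg min_(s < s0 in unmatched_nbrs M r) rank s]%O, r) |: M
  else M.

Definition ranking (arr : seq (request G)) : {set server G * request G} :=
  foldl ranking_step (finset.set0 : {set server G * request G}) arr.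

End Ranking.

Section ProductMeasure.
Context {d : measure_display} {T : measurableType d} {R : realType}.

Definition tcons (n : nat) (x : T * n.-tuple T) : n.+1.-tuple T :=
  [the n.+1.-tuple T of x.1 :: x.2].

Lemma measurable_tcons (n : nat) : measurable_fun setT (@tcons n).
Proof. exact: measurable_cons. Qed.

HB.instance Definition _ (n : nat) :=
  isMeasurableFun.Build _ _ _ _ (@tcons n) (@measurable_tcons n).

(* The law of [n] independent draws from [P]: the image of
   P x (P x (... x dirac)) under the identification of T * T^n with T^n.+1. *)
Fixpoint iid (P : probability T R) (n : nat) : probability (n.-tuple T) R :=
  if n is m.+1 then distribution (P \x iid P m)%E (@tcons m)
  else dirac [tuple].

End ProductMeasure.

Definition ranks (R : realType) (n : nat) :
    probability (n.-tuple (measurableTypeR R)) R :=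
  iid (uniform_prob (@ltr01 R)) n.

Definition ranking_ALG (R : realType) (I : instance) : \bar R :=
  ('E_(ranks R #|server (graph I)|)
     [fun t => #|ranking (fun s => tnth t (enum_rank s)) (arrival I)|%:R])%E.

(* Instances with OPT = 0 have no ratio and are left out. *)
Definition competitive_ratio (R : realType) (C : bigraph -> Prop)
    (ALG : instance -> \bar R) : \bar R :=
  ereal_inf [set x | exists2 I : instance,
    C (graph I) /\ (0 < OPT (graph I))%N
    & x = (ALG I / (OPT (graph I))%:R%:E)%E]%classic.

(* Main.v *)
Require Import Defs.
From mathcomp Require Import all_boot all_order all_algebra.
From mathcomp Require Import all_classical all_reals all_analysis.
From mathcomp Require Import unstable measurable_realfun ring lra zify.

(* The bad instance, with m = d - 1, has m contested servers and k safe ones.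
   The i-th of k shared requests is adjacent to all contested servers and to
   the i-th safe server; afterwards every safe server gets k - 1 >= 1 private
   requests.  Some matching covers all m + k servers, and whatever RANKING does,
   a contested server left over by the shared requests stays unmatched.  It
   therefore suffices that on average at least m (1 - 1/d)^k contested servers
   are left over.

   Only the least rank among the contested servers matters for the next shared
   request: it is removed unless the fresh rank of the safe server is smaller.
   For F(n, k, x), the mean number of leftovers when the least rank is x and n
   other ranks are uniform on [x, 1], and G(n, k, b), the mean number when n
   ranks are uniform on [b, 1],
     F(n, k + 1, x) = x F(n, k, x) + (1 - x) G(n, k, x),
   and G(n + 1, k, b) is the average of F(n, k, x) over the law of the minimum.
   By induction, F(n, k, x) >= (n + 1) (1 - (1 - x) / (n + 1))^k, and Jensen's
   inequality turns this into
     G(n + 1, k, b) >= (n + 1) (1 - (1 - b) / (n + 2))^k.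
   The wanted bound is the case n + 1 = m, b = 0. *)

Set Implicit Arguments.
Unset Strict Implicit.
Unset Printing Implicit Defensive.

Import Order.TTheory GRing.Theory Num.Theory.
Import numFieldNormedType.Exports.
Local Open Scope classical_set_scope.
Local Open Scope ring_scope.

(** * Integrals against independent draws *)

Section IidIntegral.
Context (R : realType).
Notation RT := (measurableTypeR R).
Notation unif := (uniform_prob (@ltr01 R)).

(** Draws are handled as plain lists of fixed length, because sorting and thinning recurse on lists.
    Measurability is coordinatewise; beyond the length, [nth] gives the constant 0. *)
Definition seq_measurable d (T : measurableType d) n (f : T -> seq R) : Prop :=
  (forall w, size (f w) = n) /\
  (forall i, measurable_fun setT (fun w => nth 0 (f w) i : RT)).

Definition tuple_measurable n (F : seq R -> \bar R) : Prop :=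
  measurable_fun setT (fun t : n.-tuple RT => F (tval t)).

Lemma tuple_measurable_comp d (T : measurableType d) n F (f : T -> seq R) :
  tuple_measurable n F -> seq_measurable n f ->
  measurable_fun setT (fun w => F (f w)).
Proof.
move=> mF [sf mf].
pose g w : n.-tuple RT := Tuple (introT eqP (sf w)).
have mg : measurable_fun setT g.
  apply/measurable_fun_tnthP => i.
  rewrite (_ : _ \o _ = fun w => nth 0 (f w) i); first exact: mf.
  by apply/funext => w /=; rewrite (tnth_nth 0).
exact: (measurableT_comp mF mg).
Qed.

Lemma seq_measurable_tuple n : seq_measurable n (fun t : n.-tuple RT => tval t : seq R).
Proof.
split=> [w|i]; first by rewrite size_tuple.
have [lt_in|le_ni] := ltnP i n.
  rewrite (_ : (fun _ => _) = (fun t => tnth t (Ordinal lt_in))).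
    exact: measurable_tnth.
  by apply/funext => w; rewrite (tnth_nth 0).
rewrite (_ : (fun _ => _) = cst 0); first exact: measurable_cst.
by apply/funext => w; rewrite nth_default// size_tuple.
Qed.

Lemma seq_measurable_comp d d' (T : measurableType d) (T' : measurableType d')
    n (f : T -> seq R) (g : T' -> T) :
  measurable_fun setT g -> seq_measurable n f -> seq_measurable n (f \o g).
Proof.
move=> mg [sf mf]; split=> [w|i]; first exact: sf.
exact: (measurableT_comp (mf i) mg).
Qed.

Lemma seq_measurable_cons d (T : measurableType d) n (x : T -> RT) (f : T -> seq R) :
  measurable_fun setT x -> seq_measurable n f ->
  seq_measurable n.+1 (fun w => (x w : R) :: f w).
Proof.
by move=> mx [sf mf]; split=> [w|[|i]] //=; rewrite sf.
Qed.

Lemma seq_measurable_head d (T : measurableType d) n (f : T -> seq R) :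
  seq_measurable n f -> measurable_fun setT (fun w => head 0 (f w) : RT).
Proof.
move=> [_ /(_ 0%N)]; congr (measurable_fun _ _).

Qed.

Lemma seq_measurable_behead d (T : measurableType d) n (f : T -> seq R) :
  seq_measurable n.+1 f -> seq_measurable n (fun w => behead (f w)).
Proof.
move=> [sf mf]; split=> [w|i]; first by rewrite size_behead sf.
by have := mf i.+1; congr (measurable_fun _ _); apply/funext => w; rewrite nth_behead.
Qed.

Lemma seq_measurable_cat d (T : measurableType d) m n (f g : T -> seq R) :
  seq_measurable m f -> seq_measurable n g ->
  seq_measurable (m + n) (fun w => f w ++ g w).
Proof.
move=> [sf mf] [sg mg]; split=> [w|i]; first by rewrite size_cat sf sg.
have [lt_im|le_mi] := ltnP i m.
  rewrite (_ : (fun _ => _) = (fun w => nth 0 (f w) i)) //.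
  by apply/funext => w; rewrite nth_cat sf lt_im.
rewrite (_ : (fun _ => _) = (fun w => nth 0 (g w) (i - m))) //.
by apply/funext => w; rewrite nth_cat sf ltnNge le_mi.
Qed.

Lemma measurable_iid_integral d (T : measurableType d) n
    (h : T -> seq R -> \bar R) :
  (forall w s, 0 <= h w s)%E ->
  measurable_fun setT (fun z : T * n.-tuple RT => h z.1 (tval z.2)) ->
  measurable_fun setT (fun w => \int[iid unif n]_t h w (tval t))%E.
Proof.
move=> h0 mh.
exact: (measurable_fun_fubini_tonelli_F (m2 := iid unif n)
  (fun z : T * n.-tuple RT => h z.1 (tval z.2)) mh).
Qed.

Lemma tuple_measurable_cons n (F : seq R -> \bar R) :
  tuple_measurable n.+1 F ->
  measurable_fun setT (fun z : RT * n.-tuple RT => F ((z.1 : R) :: tval z.2)).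
Proof.
move=> mF; apply: (tuple_measurable_comp mF).
apply: seq_measurable_cons => //.
exact: (seq_measurable_comp measurable_snd (seq_measurable_tuple n)).
Qed.

Lemma integral_iidS n (F : seq R -> \bar R) :
  (forall s, 0 <= F s)%E -> tuple_measurable n.+1 F ->
  (\int[iid unif n.+1]_t F (tval t) =
   \int[unif]_x \int[iid unif n]_t F ((x : R) :: tval t))%E.
Proof.
move=> F0 mF.
rewrite [LHS]/= ge0_integral_distribution//.
rewrite fubini_tonelli1//; last by move=> z; exact: F0.
exact: (tuple_measurable_cons mF).
Qed.

Lemma integral_iid0 (F : seq R -> \bar R) :
  (forall s, 0 <= F s)%E -> tuple_measurable 0 F ->
  (\int[iid unif 0]_t F (tval t) = F [::])%E.
Proof.
by move=> F0 mF; rewrite /= integral_dirac// diracT mul1e.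
Qed.

Lemma tuple_measurable_iid_integral m n (F : seq R -> \bar R) :
  (forall s, 0 <= F s)%E -> tuple_measurable (m + n) F ->
  tuple_measurable m (fun s : seq R => \int[iid unif n]_t F (s ++ tval t))%E.
Proof.
move=> F0 mF.
apply: (measurable_iid_integral (h := fun (s : m.-tuple RT) t => F (tval s ++ t)))=> //.
apply: (tuple_measurable_comp mF); apply: seq_measurable_cat.
  exact: (seq_measurable_comp measurable_fst (seq_measurable_tuple _)).
exact: (seq_measurable_comp measurable_snd (seq_measurable_tuple _)).
Qed.

Lemma integral_iid_cat m n (F : seq R -> \bar R) :
  (forall s, 0 <= F s)%E -> tuple_measurable (m + n) F ->
  (\int[iid unif (m + n)]_t F (tval t) =
   \int[iid unif m]_s \int[iid unif n]_t F (tval s ++ tval t))%E.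
Proof.
elim: m F => [|m IH] F F0 mF; have mG := tuple_measurable_iid_integral F0 mF.
  by rewrite [RHS](integral_iid0 _ mG)// => s; apply: integral_ge0.
rewrite [RHS](integral_iidS _ mG); last by move=> s; apply: integral_ge0.
rewrite [LHS]integral_iidS//; apply: eq_integral => x _.
rewrite [LHS](IH (fun s => F ((x:R) :: s)))//.
apply: (tuple_measurable_comp mF); apply: seq_measurable_cons => //.
exact: seq_measurable_tuple.
Qed.

End IidIntegral.

(** * Sorting the draws *)

Section InsertionSort.
Context (R : realType).
Implicit Types (x y : R) (s t : seq R).
Notation RT := (measurableTypeR R).
Notation unif := (uniform_prob (@ltr01 R)).

(** Written with min and max rather than a test, so that every entry of the result is visibly a
    measurable function of the inputs. *)
Fixpoint insert x s : seq R :=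
  if s is y :: s' then Num.min x y :: insert (Num.max x y) s' else [:: x].

Definition isort s : seq R := foldr insert [::] s.

Lemma perm_insert x s : perm_eq (insert x s) (x :: s).
Proof.
elim: s x => [|y s IH] x //=.
apply: (@perm_trans _ (Num.min x y :: Num.max x y :: s)); first by rewrite perm_cons.
case: leP => // _.
by rewrite -[_ :: _]/([:: y; x] ++ s) -[_ :: _ :: s in X in perm_eq _ X]/([:: x; y] ++ s) perm_cat2r (perm_catC [:: y] [:: x]).
Qed.

Lemma perm_isort s : perm_eq (isort s) s.
Proof.
elim: s => //= x s IH.
by apply: perm_trans (perm_insert _ _) _; rewrite perm_cons.
Qed.

Lemma size_isort s : size (isort s) = size s.
Proof. exact: perm_size (perm_isort s). Qed.

Lemma insert_path x s : path <=%R x s -> insert x s = x :: s.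
Proof.
elim: s x => //= y s IH x /andP[le_xy ys].
by rewrite min_l // max_r // IH.
Qed.

Lemma insert_sorted x s : sorted <=%R s -> sorted <=%R (insert x s).
Proof.
elim: s x => //= y s IH x ys.
rewrite path_sortedE; last exact: le_trans.
rewrite IH ?(path_sorted ys)// andbT (perm_all _ (perm_insert _ _)) /=.
rewrite le_max ge_min lexx /=.
have := ys; rewrite path_sortedE; last exact: le_trans.
by move=> /andP[/allP ays _]; apply/allP => z zs; rewrite ge_min ays ?orbT.
Qed.

Lemma isort_sorted s : sorted <=%R (isort s).
Proof. by elim: s => //= x s; exact: insert_sorted. Qed.

Lemma all_isort (a : pred R) s : all a (isort s) = all a s.
Proof. exact: perm_all (perm_isort s). Qed.

Lemma seq_measurable_eq d (T : measurableType d) n (f g : T -> seq R) :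
  f =1 g -> seq_measurable n f -> seq_measurable n g.
Proof. by move=> /funext ->. Qed.

Lemma seq_measurable_insert d (T : measurableType d) n (x : T -> RT) (f : T -> seq R) :
  measurable_fun setT x -> seq_measurable n f ->
  seq_measurable n.+1 (fun w => insert (x w) (f w)).
Proof.
elim: n x f => [|n IH] x f mx mf.
  apply: (@seq_measurable_eq _ _ _ (fun w => (x w : R) :: f w)).
    by move=> w; have /size0nil -> := mf.1 w.
  exact: seq_measurable_cons.
have mh := seq_measurable_head mf.
pose g w := (Num.min (x w) (head 0 (f w)) : R) ::
  insert (Num.max (x w) (head 0 (f w))) (behead (f w)).
apply: (@seq_measurable_eq _ _ _ g).
  by move=> w; rewrite /g; have := mf.1 w; case: (f w).
apply: seq_measurable_cons; first exact: measurable_minr.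
apply: IH; first exact: measurable_maxr.
exact: seq_measurable_behead.
Qed.

Lemma seq_measurable_isort d (T : measurableType d) n (f : T -> seq R) :
  seq_measurable n f -> seq_measurable n (fun w => isort (f w)).
Proof.
elim: n f => [|n IH] f mf.
  by apply: (seq_measurable_eq _ mf) => w; have /size0nil -> := mf.1 w.
pose g w := insert (head 0 (f w)) (isort (behead (f w))).
apply: (@seq_measurable_eq _ _ _ g).
  by move=> w; rewrite /g; have := mf.1 w; case: (f w).
apply: seq_measurable_insert; first exact: (seq_measurable_head mf).
by apply: IH; exact: seq_measurable_behead.
Qed.

Lemma measurable_all_gt d (T : measurableType d) n (x : T -> RT) (f : T -> seq R) :
  measurable_fun setT x -> seq_measurable n f ->
  measurable_fun setT (fun w => all (> (x w : R)) (f w)).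
Proof.
elim: n f => [|n IH] f mx mf.
  rewrite (_ : (fun _ => _) = cst true); first exact: measurable_cst.
  by apply/funext => w; have /size0nil -> := mf.1 w.
pose g w := (x w < head 0 (f w)) && all (> (x w : R)) (behead (f w)).
rewrite (_ : (fun _ => _) = g); last first.
  by apply/funext => w; rewrite /g; have := mf.1 w; case: (f w).
apply: measurable_and.
  apply: measurable_fun_ltr => //; exact: (seq_measurable_head mf).
by apply: IH => //; exact: seq_measurable_behead.
Qed.

End InsertionSort.

(** * Splitting off the least draw *)

Section MinDecomposition.
Context (R : realType).
Implicit Types (x y : R) (s t : seq R).
Notation RT := (measurableTypeR R).
Notation unif := (uniform_prob (@ltr01 R)).

(** Conditioning on all draws exceeding [x] is replaced by restriction to that event, which avoids
    dividing by its probability. *)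
Definition above (F : seq R -> \bar R) x s : \bar R :=
  if all (> x) s then F (isort s) else 0%E.

Lemma above_ge0 F x s : (forall s, 0 <= F s)%E -> (0 <= above F x s)%E.
Proof. by move=> F0; rewrite /above; case: ifP. Qed.

Lemma measurable_above d (T : measurableType d) n (F : T -> seq R -> \bar R)
    (x : T -> RT) (f : T -> seq R) :
  measurable_fun setT x -> seq_measurable n f ->
  measurable_fun setT (fun w => F w (isort (f w))) ->
  measurable_fun setT (fun w => above (F w) (x w) (f w)).
Proof.
move=> mx mf mF; apply: measurable_fun_ifT => //.
exact: measurable_all_gt mx mf.
Qed.

(** Either [x] is the strict minimum, or the old minimum stays in front and [x] goes into the tail.
    On a tie of [x] with the head, both summands vanish. *)
Lemma insert_head_ge0 (Psi : seq R -> \bar R) x s :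
  (forall s, 0 <= Psi s)%E -> s != [::] -> sorted <=%R s ->
  ((if all (> x)%R s then Psi (x :: s) else 0) +
   (if (head 0 s < x)%R then Psi ((head 0 s)%R :: insert x (behead s)) else 0)
   <= Psi (insert x s))%E.
Proof.
move=> Psi0; case: s => // y s _ ys /=.
case: (ltP y x) => [yx|xy].
  by rewrite ltNge (ltW yx) /= add0e.
rewrite adde0; case: ifP => // _.
by rewrite insert_path.
Qed.

Lemma tuple_measurable_isort n (F : seq R -> \bar R) :
  tuple_measurable n F -> tuple_measurable n (fun s => F (isort s)).
Proof.
move=> mF.
exact: (tuple_measurable_comp mF (seq_measurable_isort (@seq_measurable_tuple R n))).
Qed.

(* Each of the [n.+1] draws is equally likely to be the least one; claiming only
   an inequality avoids showing that ties are negligible. *)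
Lemma integral_isort_ge n (Psi : seq R -> \bar R) :
  (forall s, 0 <= Psi s)%E -> tuple_measurable n.+1 Psi ->
  (n.+1%:R%:E *
     \int[unif]_x \int[iid unif n]_t above (fun s => Psi ((x : R) :: s)) x (tval t)
   <= \int[iid unif n.+1]_t Psi (isort (tval t)))%E.
Proof.
elim: n Psi => [|n IH] Psi Psi0 mPsi.
  rewrite mul1e [leRHS](integral_iidS _ (tuple_measurable_isort mPsi))//.
  rewrite le_eqVlt; apply/orP; left; apply/eqP.
  apply: eq_integral => x _; apply: eq_integral => t _.
  by rewrite (tuple0 t).
have mPsi_isort := tuple_measurable_isort mPsi.
(* The part of [Psi] where the first draw [x] is not the least. The induction hypothesis is applied
   to it with [x] fixed. *)
pose Psi' x s : \bar R := if head 0 s < x then Psi (head 0 s :: insert x (behead s)) else 0%E.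
have Psi'0 x s : (0 <= Psi' x s)%E by rewrite /Psi'; case: ifP.
have mPsi' d (T : measurableType d) (x : T -> RT) (f : T -> seq R) :
    measurable_fun setT x -> seq_measurable n.+1 f ->
    measurable_fun setT (fun w => Psi' (x w) (f w)).
  move=> mx mf; have mh := seq_measurable_head mf.
  apply: measurable_fun_ifT => //; first exact: measurable_fun_ltr.
  apply: (tuple_measurable_comp mPsi); apply: seq_measurable_cons => //.
  by apply: seq_measurable_insert => //; exact: seq_measurable_behead.
have msnd m : seq_measurable m (fun z : RT * m.-tuple RT => tval z.2 : seq R).
  exact: (seq_measurable_comp measurable_snd (@seq_measurable_tuple R _)).
have mA : measurable_fun setT (fun z : RT * n.+1.-tuple RT =>
    above (fun s => Psi ((z.1 : R) :: s)) z.1 (tval z.2)).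
  apply: (measurable_above (F := fun z s => Psi ((z.1 : R) :: s)) measurable_fst (msnd _)).
  apply: (tuple_measurable_comp mPsi); apply: seq_measurable_cons => //.
  exact: seq_measurable_isort (msnd _).
have mB : measurable_fun setT (fun z : RT * n.+1.-tuple RT =>
    Psi' z.1 (isort (tval z.2))).
  by apply: mPsi' => //; exact: seq_measurable_isort (msnd _).
have m1 d d' (T : measurableType d) (T' : measurableType d') (h : T * T' -> \bar R) w :
    measurable_fun setT h -> measurable_fun setT (fun w' => h (w, w')).
  by move=> mh; apply: (measurableT_comp mh); exact: measurable_pair1.
pose IA (x : RT) : \bar R :=
  (\int[iid unif n.+1]_t above (fun s => Psi ((x : R) :: s)) x (tval t))%E.
pose IB (x : RT) : \bar R := (\int[iid unif n.+1]_t Psi' x (isort (tval t)))%E.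
have IA0 x : (0 <= IA x)%E by apply: integral_ge0 => t _; exact: above_ge0.
have IB0 x : (0 <= IB x)%E by apply: integral_ge0.
have mIA : measurable_fun setT IA.
  apply: (measurable_iid_integral (h := fun x => above (fun s => Psi ((x : R) :: s)) x)) => //.
  by move=> *; exact: above_ge0.
have mIB : measurable_fun setT IB.
  exact: (measurable_iid_integral (h := fun x s => Psi' x (isort s))).
rewrite [leRHS](integral_iidS _ mPsi_isort)//.
apply: (@le_trans _ _ (\int[unif]_x (IA x + IB x))%E); last first.
  apply: ge0_le_integral => //.
  - by move=> x _; rewrite adde_ge0.
  - exact: emeasurable_funD.
  - apply: (measurable_iid_integral (h := fun x s => Psi (isort ((x : R) :: s)))) => //.
    exact: (tuple_measurable_cons mPsi_isort).
  - move=> x _; rewrite -ge0_integralD//; last 3 first.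
    + by move=> t _; exact: above_ge0.
    + exact: (m1 _ _ _ _ _ x mA).
    + exact: (m1 _ _ _ _ _ x mB).
    apply: ge0_le_integral => //.
    + by move=> t _; rewrite adde_ge0// above_ge0.
    + apply: emeasurable_funD; [exact: (m1 _ _ _ _ _ x mA)|exact: (m1 _ _ _ _ _ x mB)].
    + exact: (m1 _ _ _ _ _ x (tuple_measurable_cons mPsi_isort)).
    + move=> t _; rewrite /above -all_isort.
      apply: insert_head_ge0 => //; last exact: isort_sorted.
      by rewrite -size_eq0 size_isort size_tuple.
have -> : (\int[unif]_x (IA x + IB x) = \int[unif]_x IA x + \int[unif]_x IB x)%E.
  exact: ge0_integralD.
(* Of the [n.+2] equal shares, one comes from the first draw being least and [n.+1] from the
   induction hypothesis. *)
have mulSe (J : \bar R) : (n.+2%:R%:E * J = J + n.+1%:R%:E * J)%E.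
  by rewrite -(natr1 n.+1) EFinD (@ge0_muleDl _ _ n.+1%:R%:E 1%E)// mul1e addeC.
rewrite mulSe; apply: leeD => //.
pose C (z : RT * RT) : \bar R :=
  (\int[iid unif n]_t above (fun s => Psi' z.1 ((z.2 : R) :: s)) z.2 (tval t))%E.
have C0 z : (0 <= C z)%E by apply: integral_ge0 => t _; exact: above_ge0.
have mC : measurable_fun setT C.
  apply: (measurable_iid_integral (T := (RT * RT)%type)
    (h := fun z => above (fun s => Psi' z.1 ((z.2 : R) :: s)) z.2)).
    by move=> *; exact: above_ge0.
  have m11 : measurable_fun setT (fun z : (RT * RT) * n.-tuple RT => z.1.1).
    exact: measurableT_comp.
  have m12 : measurable_fun setT (fun z : (RT * RT) * n.-tuple RT => z.1.2).
    exact: measurableT_comp.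
  have m2 : seq_measurable n (fun z : (RT * RT) * n.-tuple RT => tval z.2 : seq R).
    exact: (seq_measurable_comp measurable_snd (@seq_measurable_tuple R _)).
  apply: (measurable_above (F := fun z s => Psi' z.1.1 ((z.1.2 : R) :: s)) m12 m2).
  apply: mPsi' => //; apply: seq_measurable_cons => //.
  exact: seq_measurable_isort.
apply: (@le_trans _ _ (\int[unif]_x (n.+1%:R%:E * \int[unif]_y C (x, y)))%E); last first.
  apply: ge0_le_integral => //.
  - by move=> x _; rewrite mule_ge0// integral_ge0.
  - apply: measurable_funeM; exact: (measurable_fun_fubini_tonelli_F (m2 := unif) C).
  - by move=> x _; apply: IH => //; apply: mPsi' => //; exact: (@seq_measurable_tuple R).
rewrite ge0_integralZl//; last 2 first.
- exact: (measurable_fun_fubini_tonelli_F (m2 := unif) C).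
- by move=> x _; apply: integral_ge0.
(* Exchanging the integrals puts the least rank [y] outside; [x] becomes one of the draws above
   it. *)
rewrite (fubini_tonelli C)//.
rewrite lee_wpmul2l// le_eqVlt; apply/orP; left; apply/eqP.
apply: eq_integral => y _.
rewrite (integral_iidS (F := above (fun s => Psi ((y : R) :: s)) y))//; last 2 first.
- by move=> s; exact: above_ge0.
- apply: (measurable_above (F := fun _ s => Psi ((y : R) :: s)) (measurable_cst y)).
    exact: (@seq_measurable_tuple R).
  apply: (tuple_measurable_comp mPsi); apply: seq_measurable_cons => //.
  by apply: seq_measurable_isort; exact: (@seq_measurable_tuple R).
apply: eq_integral => x _; apply: eq_integral => t _.
rewrite /above /=; case: ifP => [/andP[yx ->]|].
  by rewrite /Psi' /= yx.
by move=> /negbT; rewrite negb_and /Psi' /= => /orP[/negbTE->|/negbTE ->]//; case: ifP.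
Qed.

End MinDecomposition.

(** * Integrals against the uniform law *)

Section UniformIntegrals.
Context (R : realType).
Implicit Types (x y : R).
Notation RT := (measurableTypeR R).
Notation unif := (uniform_prob (@ltr01 R)).
Notation mu := (@lebesgue_measure R).

(** Convexity of the power in the form that stands in for Jensen's inequality. Multiplying the case
    of exponent [n] by [p] overshoots the next tangent by [n * q ^ n.-1 * (p - q) ^ 2]. *)
Lemma exprn_tangent_le (p q : R) n : 0 <= p -> 0 <= q ->
  q ^+ n + n%:R * q ^+ n.-1 * (p - q) <= p ^+ n.
Proof.
move=> p0 q0; elim: n => [|n IH]; first by rewrite !expr0 !mul0r addr0.
apply: (@le_trans _ _ (p * (q ^+ n + n%:R * q ^+ n.-1 * (p - q)))); last first.
  by rewrite exprS ler_wpM2l.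
case: n {IH} => [|n] /=; first by rewrite !expr0 expr1; lra.
rewrite -subr_ge0.
rewrite [X in 0 <= X](_ : _ = n.+1%:R * q ^+ n * (p - q) ^+ 2); last first.
  by rewrite -(natr1 n.+1) !exprS; ring.
by rewrite mulr_ge0 ?sqr_ge0// mulr_ge0 ?exprn_ge0.
Qed.

Lemma measurable_mem_itv (i : interval R) :
  measurable_fun setT (fun x : RT => x \in i).
Proof.
apply: (measurable_fun_bool true).
rewrite setTI (_ : _ @^-1` _ = [set` i]); first exact: measurable_itv.
by apply/seteqP; split=> x.
Qed.

Lemma integral_uniform_itv (a : itv_bound R) b (f : RT -> \bar R) :
  (BLeft 0 <= a)%O -> (b <= BRight 1)%O ->
  measurable_fun setT f -> (forall x, 0 <= f x)%E ->
  (\int[unif]_x (if x \in Interval a b then f x else 0) =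
   \int[mu]_(x in [set` Interval a b]) f x)%E.
Proof.
move=> a0 b1 mf f0.
rewrite integral_uniform//; last 2 first.
- by apply: measurable_fun_ifT => //; exact: measurable_mem_itv.
- by move=> x; case: ifP.
rewrite subr0 invr1 mul1e integral_mkcond [RHS]integral_mkcond.
apply: eq_integral => x _; rewrite !patchE.
have memE (i : interval R) : (x \in [set` i]) = (x \in i).
  by apply/idP/idP => [/set_mem|xi]; last exact: mem_set.
rewrite !memE; have [xab|xab] := boolP (x \in Interval a b); last by case: ifP.
rewrite ifT//; move: xab; rewrite !itv_boundlr => /andP[ax xb].
by rewrite (le_trans a0)// (le_trans xb).
Qed.

(** The side [c] lets one lemma serve both the strict test of [thin] and the complement of the
    strict test of [above]. *)
Lemma integral_uniform_ifT (c : bool) x (u v : \bar R) :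
  0 <= x <= 1 -> (0 <= u)%E -> (0 <= v)%E ->
  (\int[unif]_z (if z \in Interval -oo%O (BSide c x) then u else v) =
   x%:E * u + (1 - x)%:E * v)%E.
Proof.
move=> /andP[x0 x1] u0 v0.
have mI (i : interval R) (w w' : \bar R) : measurable_fun setT (fun z : RT => if z \in i then w else w' : \bar R).
  by apply: measurable_fun_ifT => //; exact: measurable_mem_itv.
transitivity (\int[unif]_z ((if z \in (Interval (BLeft 0) (BSide c x))%R then u else 0) +
   (if z \in (Interval (BSide c x) (BRight 1))%R then v else 0)))%E.
  rewrite !integral_uniform//; last 3 first.
  - by apply: emeasurable_funD; exact: mI.
  - by move=> z; apply: adde_ge0; case: ifP.
  - by move=> z; case: ifP.
  congr (_ * _)%E; apply: eq_integral => z.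
  move/set_mem; rewrite /= in_itv /= => /andP[z0 z1].
  rewrite !in_itv; case: c => /=; rewrite z0 z1 andbT /=.
    by case: (ltP z x); rewrite ?adde0 ?add0e.
  by case: (leP z x); rewrite ?adde0 ?add0e.
rewrite ge0_integralD//; [|by move=> z _; case: ifP|by move=> z _; case: ifP].
rewrite (integral_uniform_itv (f := cst u))//.
rewrite (integral_uniform_itv (f := cst v))//.
rewrite !integral_cst//= !lebesgue_measure_itv/= !lte_fin.
- rewrite muleC (muleC v); congr (_ * _ + _ * _)%E.
    move: x0; rewrite le_eqVlt => /predU1P[<-|x0]; first by rewrite ltxx.
    by rewrite x0 -EFinD subr0.
  move: x1; rewrite le_eqVlt => /predU1P[->|x1]; first by rewrite ltxx subrr.
  by rewrite x1 -EFinD.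
by case: c; rewrite bnd_simp.
Qed.

Lemma integral_uniform_onemXn b n : 0 <= b <= 1 ->
  (\int[unif]_z (if (z : R) \in `]b, 1]%R then ((1 - z) ^+ n)%:E else 0) =
   ((1 - b) ^+ n.+1 / n.+1%:R)%:E)%E.
Proof.
move=> /andP[b0 b1].
(* The absolute value makes the integrand nonnegative on the whole line, as [integral_uniform_itv]
   requires. *)
pose f (z : RT) : \bar R := (`|1 - z| ^+ n)%:E.
transitivity (\int[unif]_z (if (z : R) \in `]b, 1]%R then f z else 0))%E.
  apply: eq_integral => z _; case: ifPn => //.
  by rewrite in_itv /= => /andP[_ z1]; rewrite /f ger0_norm// subr_ge0.
have mf : measurable_fun setT f.
  apply/measurable_EFinP; apply: measurable_funX.
  by apply: measurableT_comp => //; exact: measurable_funB.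
rewrite integral_uniform_itv//; last by move=> z; rewrite lee_fin exprn_ge0.
move: b1; rewrite le_eqVlt => /predU1P[->|b1].
  by rewrite set_itvoc0 integral_set0 subrr expr0n mul0r.
rewrite integral_itv_obnd_cbnd; last first.
  exact: measurable_funTS.
transitivity (\int[mu]_(z in `[b, 1%R]) ((1 - z) ^+ n)%:E)%E.
  apply: eq_integral => z /set_mem; rewrite /= in_itv /= => /andP[_ z1].
  by rewrite /f ger0_norm// subr_ge0.
pose F (z : R) : R := onem z ^+ n.+1 / - n.+1%:R.
have dF z : derivable F z 1 by apply: derivableM => //; exact: onemXn_derivable.
have cF : continuous F.
  by move=> z; apply: differentiable_continuous; exact/derivable1_diffP.
rewrite (@continuous_FTC2 _ _ F)//.
- by rewrite /F onem1 expr0n mul0r sub0e -EFinN invrN mulrN opprK.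
- by apply: continuous_in_subspaceT => z _; exact: continuous_onemXn.
- split => //.
  + exact: cvg_at_right_filter (cF b).
  + exact: cvg_at_left_filter (cF 1).
- move=> z _; rewrite derive1Mr//; last exact: onemXn_derivable.
  by rewrite derive_onemXn mulrAC divff// mul1r.
Qed.

End UniformIntegrals.

(** * Mean number of leftover contested servers *)

Section Survivors.
Context (R : realType).
Implicit Types (x y : R) (s g : seq R).
Notation RT := (measurableTypeR R).
Notation unif := (uniform_prob (@ltr01 R)).

(* [s] lists the ranks of the unmatched contested servers in increasing order,
   [x] is the rank of the safe server of the arriving request. *)
Definition thin s x : seq R :=
  if s is y :: s' then if x < y then s else s' else [::].

Definition survivors s g : nat := size (foldl thin s g).

Lemma survivors_nil g : survivors [::] g = 0%N.
Proof. by elim: g. Qed.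

Lemma measurable_survivors d (T : measurableType d) n k (f g : T -> seq R) :
  seq_measurable n f -> seq_measurable k g ->
  measurable_fun setT (fun w => (survivors (f w) (g w))%:R%:E : \bar R).
Proof.
elim: k n f g => [|k IH] n f g mf mg.
  rewrite (_ : (fun _ => _) = cst n%:R%:E); first exact: measurable_cst.
  by apply/funext => w; have /size0nil -> := mg.1 w; rewrite /survivors mf.1.
case: n mf => [|n] mf.
  rewrite (_ : (fun _ => _) = cst 0%E); first exact: measurable_cst.
  by apply/funext => w; have /size0nil -> := mf.1 w; rewrite survivors_nil.
pose h w : \bar R := if head 0 (g w) < head 0 (f w)
  then (survivors (f w) (behead (g w)))%:R%:E
  else (survivors (behead (f w)) (behead (g w)))%:R%:E.
rewrite (_ : (fun _ => _) = h); last first.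
  apply/funext => w; rewrite /h; have := mf.1 w; have := mg.1 w.
  by case: (g w) => // x g' _; case: (f w) => // y f' _; rewrite /survivors /=; case: ifP.
apply: measurable_fun_ifT.
- exact: measurable_fun_ltr (seq_measurable_head mg) (seq_measurable_head mf).
- by apply: (IH n.+1) => //; exact: seq_measurable_behead.
- by apply: (IH n); exact: seq_measurable_behead.
Qed.

Definition mean_survivors k s : \bar R :=
  (\int[iid unif k]_g (survivors s (tval g))%:R%:E)%E.

Lemma mean_survivors_ge0 k s : (0 <= mean_survivors k s)%E.
Proof. by apply: integral_ge0 => g _; rewrite lee_fin. Qed.

Lemma measurable_mean_survivors n k : tuple_measurable n (mean_survivors k).
Proof.
apply: (measurable_iid_integral (h := fun (s : n.-tuple RT) g => (survivors (tval s) g)%:R%:E)).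
  by move=> *; rewrite lee_fin.
apply: (measurable_survivors (n := n) (k := k)).
  exact: (seq_measurable_comp measurable_fst (@seq_measurable_tuple R _)).
exact: (seq_measurable_comp measurable_snd (@seq_measurable_tuple R _)).
Qed.

Lemma tuple_measurable_survivors k s :
  tuple_measurable k (fun g => (survivors s g)%:R%:E).
Proof.
apply: (measurable_survivors (n := size s) (k := k)).
  by split=> // i; exact: measurable_cst.
exact: (@seq_measurable_tuple R).
Qed.

Lemma mean_survivors0 s : mean_survivors 0 s = (size s)%:R%:E.
Proof.
rewrite /mean_survivors (integral_iid0 _ (@tuple_measurable_survivors 0 s))//.
Qed.

Lemma mean_survivorsS k x s : 0 <= x <= 1 ->
  mean_survivors k.+1 (x :: s) =
  (x%:E * mean_survivors k (x :: s) + (1 - x)%:E * mean_survivors k s)%E.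
Proof.
move=> x01.
rewrite /mean_survivors (integral_iidS _ (@tuple_measurable_survivors k.+1 _)); last first.
  by move=> g; rewrite lee_fin.
rewrite -(integral_uniform_ifT true x01 (mean_survivors_ge0 _ _) (mean_survivors_ge0 _ _)).
apply: eq_integral => z _; rewrite in_itv /= /mean_survivors /survivors /=.
by case: ifP.
Qed.

Definition mean_above (F : seq R -> \bar R) n x : \bar R :=
  (\int[iid unif n]_s above F x (tval s))%E.

Lemma tuple_measurable_above F n x :
  tuple_measurable n F -> tuple_measurable n (above F x).
Proof.
move=> mF; apply: (measurable_above (F := fun _ => F) (measurable_cst x)).
  exact: (@seq_measurable_tuple R).
exact: tuple_measurable_isort.
Qed.

Lemma mean_above_ge0 F n x : (forall s, 0 <= F s)%E -> (0 <= mean_above F n x)%E.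
Proof. by move=> F0; apply: integral_ge0 => s _; exact: above_ge0. Qed.

(** The factor [(1 - x) ^+ n] is the probability that [n] independent draws all exceed [x]. *)
Lemma mean_above_cst n x (c : R) : 0 <= x <= 1 -> 0 <= c ->
  mean_above (fun=> c%:E) n x = ((1 - x) ^+ n * c)%:E.
Proof.
move=> x01 c0; elim: n => [|n IH]; rewrite /mean_above.
  rewrite (integral_iid0 _ (@tuple_measurable_above _ _ x _)) ?expr0 ?mul1r//.
    by move=> s; exact: above_ge0.
  exact: measurable_cst.
rewrite (integral_iidS _ (@tuple_measurable_above _ _ x _)); last 2 first.
- by move=> s; exact: above_ge0.
- exact: measurable_cst.
have cn0 : 0 <= (1 - x) ^+ n * c.
  by case/andP: x01 => _ x1; rewrite mulr_ge0// exprn_ge0// subr_ge0.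
transitivity (\int[unif]_z (if (z : R) \in `]-oo, x]%R then 0 else ((1 - x) ^+ n * c)%:E))%E.
  apply: eq_integral => z _; rewrite in_itv /= -IH; case: leP => [zx|xz].
    apply: integral0_eq => s _; by rewrite /above /= ltNge zx.
  by apply: eq_integral => s _; rewrite /above /= xz.
by rewrite (integral_uniform_ifT false)// mule0 add0e -EFinM exprS mulrA.
Qed.

(* Like [mean_above], not normalised: [F] and [G] of the header are [mean_least]
   and [mean_above (mean_survivors k)] divided by [(1 - x) ^+ n]. *)
Definition mean_least n k x : \bar R :=
  mean_above (fun s => mean_survivors k (x :: s)) n x.

Lemma measurable_mean_least n k : measurable_fun setT (mean_least n k : RT -> \bar R).
Proof.
apply: (measurable_iid_integral
  (h := fun x => above (fun s => mean_survivors k ((x : R) :: s)) x)).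
  by move=> x s; apply: above_ge0 => ?; exact: mean_survivors_ge0.
have msnd : seq_measurable n (fun z : RT * n.-tuple RT => tval z.2 : seq R).
  exact: (seq_measurable_comp measurable_snd (@seq_measurable_tuple R _)).
apply: (measurable_above (F := fun z s => mean_survivors k ((z.1 : R) :: s)) measurable_fst msnd).
apply: (tuple_measurable_comp (@measurable_mean_survivors n.+1 k)).
by apply: seq_measurable_cons => //; exact: seq_measurable_isort.
Qed.

Lemma mean_least0 n x : 0 <= x <= 1 ->
  mean_least n 0 x = ((1 - x) ^+ n * n.+1%:R)%:E.
Proof.
move=> x01; rewrite -mean_above_cst//.
apply: eq_integral => s _; rewrite /above; case: ifP => // _.
by rewrite mean_survivors0 /= size_isort size_tuple.
Qed.

(** Integrates [mean_survivorsS] over the other ranks. Once [x] is removed, these are still only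
    known to exceed [x], so the second term keeps the threshold [x]. *)
Lemma mean_leastS n k x : 0 <= x <= 1 ->
  mean_least n k.+1 x =
  (x%:E * mean_least n k x + (1 - x)%:E * mean_above (mean_survivors k) n x)%E.
Proof.
move=> x01; have /andP[x0 x1] := x01.
have F0 : forall s, (0 <= mean_survivors k (x :: s))%E by move=> s; exact: mean_survivors_ge0.
have G0 : forall s, (0 <= mean_survivors k s)%E by move=> s; exact: mean_survivors_ge0.
have mF : tuple_measurable n (fun s => mean_survivors k (x :: s)).
  apply: (tuple_measurable_comp (@measurable_mean_survivors n.+1 k)).
  by apply: seq_measurable_cons => //; exact: (@seq_measurable_tuple R).
have mG := @measurable_mean_survivors n k.
have mF' := @tuple_measurable_above _ _ x mF.
have mG' := @tuple_measurable_above _ _ x mG.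
pose A (t : n.-tuple RT) := above (fun s => mean_survivors k (x :: s)) x (tval t).
pose B (t : n.-tuple RT) := above (mean_survivors k) x (tval t).
have A0 t : (0 <= A t)%E by exact: above_ge0.
have B0 t : (0 <= B t)%E by exact: above_ge0.
have x1' : (0 <= (1 - x)%:E)%E by rewrite lee_fin subr_ge0.
transitivity (\int[iid unif n]_t (x%:E * A t + (1 - x)%:E * B t))%E.
  apply: eq_integral => t _; rewrite /A /B /above.
  by case: ifP => _; [exact: mean_survivorsS|rewrite !mule0 adde0].
rewrite ge0_integralD//; last 4 first.
- by move=> t _; rewrite mule_ge0.
- exact: measurable_funeM.
- by move=> t _; rewrite mule_ge0.
- exact: measurable_funeM.
by rewrite !ge0_integralZl.
Qed.

End Survivors.

Arguments thin {R} s x.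

(** * Lower bound on the mean number of leftovers *)

Section LowerBound.
Context (R : realType).
Implicit Types (x y b : R).
Notation RT := (measurableTypeR R).
Notation unif := (uniform_prob (@ltr01 R)).

Definition least_bound n k x : R :=
  (1 - x) ^+ n * n.+1%:R * (1 - (1 - x) / n.+1%:R) ^+ k.

Definition above_bound n k x : R :=
  (1 - x) ^+ n * n%:R * (1 - (1 - x) / n.+1%:R) ^+ k.

Lemma ratio_bounds n x : 0 <= x <= 1 -> 0 <= 1 - (1 - x) / n.+1%:R <= 1.
Proof.
move=> /andP[x0 x1].
have : 0 <= (1 - x) / n.+1%:R <= 1.
  rewrite divr_ge0 ?subr_ge0//= ler_pdivrMr ?ltr0n// mul1r.
  by apply: (@le_trans _ _ 1); [rewrite gerBl|rewrite ler1n].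
by rewrite subr_ge0 gerBl => /andP[-> ->].
Qed.

Lemma least_bound_ge0 n k x : 0 <= x <= 1 -> 0 <= least_bound n k x.
Proof.
move=> x01; have /andP[r0 _] := ratio_bounds n x01.
have /andP[_ x1] := x01.
by rewrite /least_bound !mulr_ge0// exprn_ge0// subr_ge0.
Qed.

(** Both bounds have the same base, so this reduces to [x (n + 1) + (1 - x) n = (n + 1) (1 - (1 - x)
    / (n + 1))]. *)
Lemma least_boundS n k x :
  least_bound n k.+1 x = x * least_bound n k x + (1 - x) * above_bound n k x.
Proof.
have n0 : n%:R + 1 != 0 :> R by rewrite natr1 pnatr_eq0.
rewrite /least_bound /above_bound exprS -!natr1.
set P := (1 - (1 - x) / (n%:R + 1)) ^+ k.
by field.
Qed.

Lemma mean_least_ge n k x : 0 <= x <= 1 ->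
  (forall k, (above_bound n k x)%:E <= mean_above (mean_survivors k) n x)%E ->
  ((least_bound n k x)%:E <= mean_least n k x)%E.
Proof.
move=> x01 H; have /andP[x0 x1] := x01.
elim: k => [|k IH].
  by rewrite mean_least0// /least_bound expr0 mulr1.
rewrite mean_leastS// least_boundS EFinD !EFinM.
apply: leeD; apply: lee_wpmul2l => //.
  by rewrite lee_fin subr_ge0.
by have := H k; rewrite /above_bound !EFinM.
Qed.

Lemma mean_above_ge_mean_least n k b :
  (n.+1%:R%:E * \int[unif]_x (if (b < x)%R then mean_least n k x else 0) <=
   mean_above (mean_survivors k) n.+1 b)%E.
Proof.
(* On a sorted nonempty list, comparing [b] with the head amounts to comparing it with all entries,
   so [Psi] of the sorted draws integrates to [mean_above]. *)
pose Psi (s : seq R) : \bar R := if b < head 0 s then mean_survivors k s else 0%E.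
have Psi0 s : (0 <= Psi s)%E by rewrite /Psi; case: ifP => // _; exact: mean_survivors_ge0.
have mPsi : tuple_measurable n.+1 Psi.
  apply: measurable_fun_ifT => //; last exact: measurable_mean_survivors.
  apply: measurable_fun_ltr => //.
  exact: (seq_measurable_head (@seq_measurable_tuple R n.+1)).
have := integral_isort_ge Psi0 mPsi.
rewrite [X in (_ * X <= _)%E -> _](_ : _ =
    \int[unif]_x (if (b < x)%R then mean_least n k x else 0))%E; last first.
  apply: eq_integral => x _; rewrite /mean_least /mean_above /above /Psi /=.
  case: ifP => // _; apply: integral0_eq => t _; by case: ifP.
rewrite [X in (_ <= X)%E -> _](_ : _ = mean_above (mean_survivors k) n.+1 b)//.
apply: eq_integral => t _; rewrite /above /Psi -all_isort.
have := isort_sorted (tval t); have : size (isort (tval t)) = n.+1.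
  by rewrite size_isort size_tuple.
case: (isort (tval t)) => // y s _ /= ys.
suff -> : (b < y) && all (> b) s = (b < y) by [].
apply/andb_idr => lt_by; have := order_path_min le_trans ys.
by apply: sub_all => z; exact: lt_le_trans.
Qed.

Lemma measurable_least_bound n k :
  measurable_fun setT (least_bound n k : RT -> R).
Proof.
have m1 : measurable_fun setT (fun x : RT => 1 - x : R) by exact: measurable_funB.
apply: measurable_funM; first by apply: measurable_funM => //; exact: measurable_funX.
apply: measurable_funX; apply: measurable_funB => //.
exact: measurable_funM.
Qed.

(* Replaces the power in [least_bound] by its tangent at the mean
   [(1 - b) / n.+2] of [(1 - x) / n.+1]; the linear term then integrates to 0. *)
Lemma integral_least_bound_ge n k b : 0 <= b <= 1 ->
  ((above_bound n.+1 k b)%:E <=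
    n.+1%:R%:E * \int[unif]_x (if (x : R) \in `]b, 1]%R then (least_bound n k x)%:E else 0))%E.
Proof.
move=> b01; have /andP[b0 b1] := b01.
have /andP[q0 q1] := ratio_bounds n.+1 b01.
(* The tangent at [q], multiplied by [N (1 - x) ^ n], is [A (1 - x) ^ n - B (1 - x) ^ n.+1]. The [B]
   term is moved to the other side below to keep all integrands nonnegative. *)
pose N : R := n.+1%:R; pose c := (1 - b) / n.+2%:R; pose q := 1 - c.
pose B := k%:R * q ^+ k.-1; pose A := N * (q ^+ k + B * c).
have B0 : 0 <= B by rewrite mulr_ge0// exprn_ge0.
have A0 : 0 <= A.
  rewrite mulr_ge0// addr_ge0 ?exprn_ge0// mulr_ge0// divr_ge0// subr_ge0//.
pose I m (x : RT) : \bar R := if (x : R) \in `]b, 1]%R then ((1 - x) ^+ m)%:E else 0%E.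
pose J (x : RT) : \bar R :=
  if (x : R) \in `]b, 1]%R then (least_bound n k x)%:E else 0%E.
have itv x : x \in `]b, 1]%R -> 0 <= x <= 1.
  by rewrite in_itv /= => /andP[bx ->]; rewrite (le_trans b0 (ltW bx)).
have I0 m x : (0 <= I m x)%E.
  rewrite /I; case: ifPn => // /itv /andP[_ x1].
  by rewrite lee_fin exprn_ge0// subr_ge0.
have J0 x : (0 <= J x)%E.
  by rewrite /J; case: ifPn => // /itv x01; rewrite lee_fin least_bound_ge0.
have mI m : measurable_fun setT (I m).
  apply: measurable_fun_ifT => //; first exact: measurable_mem_itv.
  by apply/measurable_EFinP/measurable_funX; exact: measurable_funB.
have mJ : measurable_fun setT J.
  apply: measurable_fun_ifT => //; first exact: measurable_mem_itv.
  by apply/measurable_EFinP; exact: measurable_least_bound.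
have pointwise x : (A%:E * I n x <= J x + B%:E * I n.+1 x)%E.
  rewrite /I /J; case: ifPn => [/itv x01|_]; last by rewrite !mule0 adde0.
  rewrite -!EFinM -EFinD lee_fin /least_bound.
  have /andP[p0 _] := ratio_bounds n x01.
  have y0 : 0 <= (1 - x) ^+ n by rewrite exprn_ge0// subr_ge0; case/andP: x01.
  have := ler_wpM2l (mulr_ge0 y0 (ler0n R n.+1)) (exprn_tangent_le k p0 q0).
  rewrite -/c -/q -/B -/N => tangent.
  have N0 : N != 0 by rewrite pnatr_eq0.
  rewrite -lerBlDr; apply: le_trans tangent; rewrite le_eqVlt; apply/orP; left; apply/eqP.
  by rewrite exprS /A /q; field.
have : (A%:E * \int[unif]_x I n x <= \int[unif]_x J x + B%:E * \int[unif]_x I n.+1 x)%E.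
  rewrite -!ge0_integralZl// -ge0_integralD//; last 2 first.
  - by move=> x _; rewrite mule_ge0.
  - exact: measurable_funeM.
  apply: ge0_le_integral => //.
  - by move=> x _; rewrite mule_ge0.
  - exact: measurable_funeM.
  - by apply: emeasurable_funD; [exact: mJ|apply: measurable_funeM; exact: mI].
have EI m : (\int[unif]_x I m x = ((1 - b) ^+ m.+1 / m.+1%:R)%:E)%E.
  exact: integral_uniform_onemXn.
rewrite !EI -!EFinM -leeBlDr// -EFinB => le_J.
apply: le_trans (lee_wpmul2l _ le_J) => //.
rewrite -EFinM lee_fin le_eqVlt; apply/orP; left; apply/eqP.
rewrite /above_bound -/c -/q -/N /A.
have N0 : N != 0 by rewrite pnatr_eq0.
(* With this the two contributions of [B] cancel and only [q ^+ k] is left. *)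
have -> : (1 - b) ^+ n.+2 / n.+2%:R = (1 - b) ^+ n.+1 * c by rewrite exprSr mulrA.
by field.
Qed.

(** Induction on [n] for all [k] and [b] at once: the bound for [n] draws gives [mean_least_ge] for
    a least rank with [n] others, and averaging over that least rank gives the bound for [n.+1]. *)
Lemma mean_above_ge n k b : 0 <= b <= 1 ->
  ((above_bound n k b)%:E <= mean_above (mean_survivors k) n b)%E.
Proof.
elim: n k b => [|n IH] k b b01.
  rewrite /above_bound mulr0 mul0r; apply: mean_above_ge0 => s; exact: mean_survivors_ge0.
apply: le_trans (mean_above_ge_mean_least n k b).
apply: le_trans (integral_least_bound_ge n k b01) _.
rewrite lee_wpmul2l//; apply: ge0_le_integral => //.
- move=> x _; case: ifP => //; rewrite in_itv /= => /andP[bx x1].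
  by rewrite lee_fin least_bound_ge0// x1 andbT (le_trans _ (ltW bx))//; case/andP: b01.
- apply: measurable_fun_ifT => //; first exact: measurable_mem_itv.
  by apply/measurable_EFinP; exact: measurable_least_bound.
- apply: measurable_fun_ifT => //; last exact: measurable_mean_least.
  exact: measurable_fun_ltr.
- move=> x _; rewrite in_itv /=; case: ifP => [/andP[bx x1]|_].
    rewrite bx; have x01 : 0 <= x <= 1.
      by rewrite x1 andbT (le_trans _ (ltW bx))//; case/andP: b01.
    by apply: mean_least_ge => // k'; exact: IH.
  case: ifP => // _; apply: mean_above_ge0 => s; exact: mean_survivors_ge0.
Qed.

(** The case [b = 0]. Dropping the restriction to positive draws can only increase the integral, so
    no almost-everywhere argument is made. *)
Lemma mean_survivors_isort_ge n k :
  ((n%:R * (1 - n.+1%:R^-1) ^+ k)%:E <=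
   \int[iid unif n]_s mean_survivors k (isort (tval s)))%E.
Proof.
have b01 : 0 <= (0 : R) <= 1 by rewrite lexx ler01.
have := mean_above_ge n k b01.
rewrite /above_bound subr0 expr1n !mul1r => /le_trans; apply.
apply: ge0_le_integral => //.
- by move=> s _; apply: above_ge0 => ?; exact: mean_survivors_ge0.
- exact: (@tuple_measurable_above _ _ _ _ (@measurable_mean_survivors R n k)).
- exact: (tuple_measurable_isort (@measurable_mean_survivors R n k)).
- by move=> s _; rewrite /above; case: ifP => // _; exact: mean_survivors_ge0.
Qed.

End LowerBound.

(** * The bad instance *)

Section RankingMatching.
Context (R : realType) (G : bigraph) (rank : server G -> R).
Implicit Types (M : {set server G * request G}) (arr : seq (request G)).

Definition matched_once M :=
  forall s r r', (s, r) \in M -> (s, r') \in M -> r = r'.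

Variant ranking_step_spec M r : {set server G * request G} -> Prop :=
  | RankingSkip of unmatched_nbrs M r = finset.set0 : ranking_step_spec M r M
  | RankingMatch a of adj a r & (forall r', (a, r') \notin M)
      & (forall b, b \in unmatched_nbrs M r -> rank a <= rank b) :
      ranking_step_spec M r ((a, r) |: M)%SET.

Lemma ranking_stepP M r : ranking_step_spec M r (ranking_step rank M r).
Proof.
rewrite /ranking_step; case: pickP => [s0 s0U|U0]; last first.
  by constructor; apply/setP => s; rewrite U0 inE.
case: arg_minP => // a aU amin; have := aU; rewrite inE => /andP[ar /forallP aM].
by constructor.
Qed.

Lemma ranking_matched_once arr : matched_once (ranking rank arr).
Proof.
rewrite /ranking; have : matched_once (finset.set0 : {set server G * request G}).
  by move=> s r r'; rewrite inE.
elim: arr finset.set0 => //= r arr IH M HM; apply: IH.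
case: ranking_stepP => // a _ aM _ s r1 r2.
rewrite !in_setU1 !xpair_eqE => /orP[/andP[/eqP-> /eqP->]|sr1].
  by case/orP=> [/andP[_ /eqP->]//|sr2]; have := aM r2; rewrite sr2.
case/orP=> [/andP[/eqP eq_sa _]|sr2]; last exact: HM sr1 sr2.
by have := aM r1; rewrite -eq_sa sr1.
Qed.

(** Since no server is matched twice, the matching injects into the servers, and its image avoids
    [cs]. *)
Lemma card_ranking_unmatched arr (cs : seq (server G)) : uniq cs ->
  {in cs, forall c r, (c, r) \notin ranking rank arr} ->
  (#|ranking rank arr| + size cs <= #|server G|)%N.
Proof.
move=> ucs csM; have once := @ranking_matched_once arr.
set M := ranking rank arr in once csM *.
have fst_inj : {in M &, injective fst}.
  by move=> [s r] [s' r'] sM s'M /= eq_s; rewrite -eq_s in s'M *; rewrite (once _ _ _ sM s'M).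
rewrite -(card_in_imset fst_inj) -(card_uniqP ucs) -(cardsE (mem cs)).
rewrite -(cardsC [set x in cs]%SET) addnC leq_add2l subset_leq_card//.
apply/fintype.subsetP => _ /imsetP[[s r] sM ->]; rewrite !inE /=.
by apply: contraL sM => scs; exact: csM.
Qed.

End RankingMatching.

(** * The bad graph and RANKING on it *)

Section Block.
Variables (m k j : nat).

(* The servers below [m] compete with server [m + i] for the shared request
   [inl i]; the private requests [inr (i, _)] of server [m + i] come later. *)
Definition block_adj (s : 'I_(m + k)) (r : 'I_k + 'I_k * 'I_j) : bool :=
  match r with
  | inl i => (s < m)%N || (s == rshift m i)
  | inr (i, _) => s == rshift m i
  end.

Definition block : bigraph :=
  @Bigraph 'I_(m + k) ('I_k + 'I_k * 'I_j)%type block_adj.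

Lemma lshift_lt (i : 'I_m) : (lshift k i < m)%N.
Proof. exact: (ltn_ord i). Qed.

Lemma rshift_lt (i : 'I_k) : (rshift m i < m)%N = false.
Proof. by rewrite ltnNge leq_addr. Qed.

(** A contested server sees the [k] shared requests, a safe one its shared request and [j] private
    ones; a request sees at most the contested servers and one safe server. *)
Lemma block_kd_bounded : (k <= j.+1)%N -> kd_bounded k m.+1 block.
Proof.
move=> kj; split=> [s|r].
  case: (split_ordP s) => i ->.
    rewrite -[leqLHS]card_ord -cardsT -(card_imset _ (@inl_inj 'I_k ('I_k * 'I_j)%type)).
    apply: subset_leq_card; apply/fintype.subsetP => _ /imsetP[i' _ ->].
    by rewrite inE /= lshift_lt.
  apply: (leq_trans kj).
  (* [None] stands for the shared request, [Some p] for a private one. *)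
  have inj : injective (fun o : option 'I_j =>
      if o is Some p then inr (i, p) else inl i : 'I_k + 'I_k * 'I_j).
    by move=> [p|] [p'|] // [->].
  rewrite -[j in j.+1]card_ord -card_option -cardsT -(card_imset _ inj).
  apply: subset_leq_card; apply/fintype.subsetP => _ /imsetP[q _ ->].
  by rewrite inE; case: q => [p|] /=; rewrite eqxx ?orbT.
have bound (i : 'I_k) : (#|([set lshift k x | x : 'I_m] :|: [set rshift m i])%SET| <= m.+1)%N.
  apply: leq_trans (leq_card_setU _ _) _; rewrite cards1 addn1 ltnS.
  by rewrite (card_imset _ (@lshift_inj _ _)) card_ord.
case: r => [i|[i p]]; apply: leq_trans (subset_leq_card _) (bound i);
  apply/fintype.subsetP => s; rewrite !inE /=; last by move->; rewrite orbT.
case/orP=> [sm|->]; last by rewrite orbT.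
apply/orP; left; apply/imsetP; exists (Ordinal sm) => //.
exact: val_inj.
Qed.

Lemma block_OPT : (m <= k)%N -> (0 < j)%N -> (m + k <= OPT block)%N.
Proof.
move=> mk j0.
(* Contested servers take distinct shared requests, which needs [m <= k]; each safe server takes its
   first private request. *)
pose rho (s : 'I_(m + k)) : 'I_k + 'I_k * 'I_j :=
  match fintype.split s with
  | inl i => inl (widen_ord mk i)
  | inr i => inr (i, Ordinal j0)
  end.
have rho_inj : injective rho.
  move=> s s'; rewrite /rho => eq_rho; apply: (can_inj (@fintype.splitK _ _)).
  move: eq_rho; case: (fintype.split s) => i; case: (fintype.split s') => i' // [eq_i].
    by congr inl; apply: val_inj.
  by rewrite eq_i.
have rho_adj s : block_adj s (rho s).
  rewrite /rho; case: split_ordP => i -> /=; first by rewrite lshift_lt.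
  exact: eqxx.
pose M : {set server block * request block} := [set (s, rho s) | s : 'I_(m + k)]%SET.
have cM : #|M| = (m + k)%N.
  by rewrite card_imset ?card_ord// => s s' [].
rewrite -cM; apply: (leq_bigmax_cond (F := fun M : {set _} => #|M|)).
apply/andP; split; apply/forall_inP => _ /imsetP[s _ ->]; first exact: rho_adj.
apply/forall_inP => _ /imsetP[s' _ ->] /=; apply/implyP => /orP[/eqP->//|/eqP eq_rho].
by rewrite (rho_inj _ _ eq_rho).
Qed.

Definition block_arrival : seq (request block) :=
  [seq inl i | i <- enum 'I_k] ++ [seq inr p | p <- enum {: 'I_k * 'I_j}].

Lemma block_arrivalP : perm_eq block_arrival (enum (request block)).
Proof.
apply: uniq_perm; rewrite ?enum_uniq//.
  rewrite cat_uniq; apply/and3P; split.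
  - by rewrite map_inj_uniq ?enum_uniq// => ? ? [].
  - by apply/hasPn => _ /mapP[p _ ->]; apply/negP => /mapP[].
  - by rewrite map_inj_uniq ?enum_uniq// => ? ? [].
move=> r; rewrite mem_enum mem_cat [RHS]inE; case: r => [i|p].
  by rewrite map_f// mem_enum.
by rewrite [X in _ || X]map_f ?orbT// mem_enum.
Qed.

Definition block_instance : instance := Instance block_arrivalP.

Section BlockRanking.
Context (R : realType) (rank : 'I_(m + k) -> R).
Notation step := (@ranking_step R block rank).

(* A server of [cs] may stay unmatched when a tie is broken in favour of
   [rshift m i], so the state of [thin] only bounds the unmatched servers from
   below. *)
Lemma ranking_shared (l : seq 'I_k) (M : {set server block * request block})
    (cs : seq 'I_(m + k)) (s : seq R) :
  uniq l -> uniq cs -> {in cs, forall c : 'I_(m + k), (c < m)%N} ->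
  {in cs, forall (c : 'I_(m + k)) r, (c, r) \notin M} ->
  {in l, forall (i : 'I_k) r, (rshift m i, r) \notin M} ->
  sorted <=%R s -> perm_eq (map rank cs) s ->
  exists cs' : seq 'I_(m + k), [/\ uniq cs', {in cs', forall c : 'I_(m + k), (c < m)%N},
    {in cs', forall (c : 'I_(m + k)) r, (c, r) \notin foldl step M (map inl l)} &
    perm_eq (map rank cs') (foldl thin s [seq rank (rshift m i) | i <- l])].
Proof.
elim: l M cs s => [|i l IH] M cs s /=; first by exists cs.
case/andP=> il ul ucs csm csM lM ss pcs.
have thin_sorted : sorted <=%R (thin s (rank (rshift m i))).
  by case: (s) ss => //= y s' ys; case: ifP => // _; exact: path_sorted ys.
have csU c : c \in cs -> c \in unmatched_nbrs M (inl i : request block).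
  move=> ccs; rewrite inE /= csm//=; apply/forallP => r; exact: csM.
have giU : rshift m i \in unmatched_nbrs M (inl i : request block).
  by rewrite inE /= eqxx orbT; apply/forallP => r; apply: lM; rewrite inE eqxx.
case: (@ranking_stepP R block rank M (inl i)) => [U0|a ai aM amin].
  by rewrite U0 inE in giU.
have drop c y s' : c \in cs -> rank c = y -> s = y :: s' ->
    perm_eq (map rank (rem c cs)) s'.
  move=> ccs rc es; rewrite -(perm_cons y) -es -{1}rc -map_cons.
  by apply: perm_trans pcs; rewrite perm_sym; apply: perm_map; exact: perm_to_rem.
have [cs' [ucs' sub acs' pcs']] : exists cs' : seq 'I_(m + k),
    [/\ uniq cs', {subset cs' <= cs}, a \notin cs' &
        perm_eq (map rank cs') (thin s (rank (rshift m i)))].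
  (* If the matched server [a] is in [cs], its rank is the head of [s] and does not exceed that of
     the safe server, so [thin] deletes it too. Otherwise [cs] survives intact, but a server with
     the head rank is given up whenever [thin] deletes the head. *)
  have [acs|acs] := boolP (a \in cs).
    exists (rem a cs); split; rewrite ?rem_uniq ?mem_rem_uniqF//; first exact: mem_rem.
    have ras : rank a \in s by rewrite -(perm_mem pcs) map_f.
    case: (s) ss ras pcs drop => // y s' ys ras pcs' drop /=.
    have ya : rank a = y.
      apply/eqP; rewrite eq_le; apply/andP; split.
        have /mapP[c ccs ->] : y \in map rank cs by rewrite (perm_mem pcs') inE eqxx.
        exact: amin (csU _ ccs).
      move: ras; rewrite inE => /predU1P[->//|].
      exact: (allP (order_path_min le_trans ys)).
    by rewrite -ya ltNge amin//=; exact: drop acs ya erefl.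
  case: (s) ss pcs drop => [|y s'] ys pcs' drop /=.
    by exists cs; split.
  case: ifPn => gy; first by exists cs; split.
  have /mapP[c ccs yc] : y \in map rank cs by rewrite (perm_mem pcs') inE eqxx.
  exists (rem c cs); split; rewrite ?rem_uniq//; first exact: mem_rem.
    by apply: contra acs; exact: mem_rem.
  exact: drop ccs (esym yc) erefl.
apply: (IH _ cs' _ ul ucs') => //.
- by move=> c /sub; exact: csm.
- move=> c ccs' r; rewrite in_setU1 negb_or (csM _ (sub _ ccs')) andbT.
  by apply: contraNneq acs' => -[<- _].
- move=> i' i'l r; rewrite in_setU1 negb_or lM ?inE ?i'l ?orbT// andbT.
  apply/negP => /eqP[eq_a _]; move: ai; rewrite -eq_a /= rshift_lt /= => /eqP /rshift_inj eq_i.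
  by rewrite -eq_i i'l in il.
Qed.

Lemma ranking_private (l : seq ('I_k * 'I_j)) (M : {set server block * request block})
    (c : 'I_(m + k)) :
  (c < m)%N -> (forall r, (c, r) \notin M) ->
  forall r, (c, r) \notin foldl step M (map inr l).
Proof.
move=> cm; elim: l M => //= -[i p] l IH M cM; apply: IH => r.
case: (@ranking_stepP R block rank M (inr (i, p))) => // a ai _ _.
rewrite in_setU1 negb_or cM andbT; apply/negP => /eqP[eq_c _].
by move: ai cm; rewrite eq_c /= => /eqP ->; rewrite rshift_lt.
Qed.

Lemma ranking_block_survivors (s : seq R) : sorted <=%R s ->
  perm_eq [seq rank (lshift k i) | i <- enum 'I_m] s ->
  (#|@ranking R block rank block_arrival| +
   survivors s [seq rank (rshift m i) | i <- enum 'I_k] <= m + k)%N.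
Proof.
move=> ss pxs; rewrite /ranking /block_arrival.
have [|||||cs [ucs csm csM /perm_size]] :=
    @ranking_shared (enum 'I_k) finset.set0 [seq lshift k i | i <- enum 'I_m] s
      (enum_uniq _) _ _ _ _ ss _.
- by rewrite map_inj_uniq ?enum_uniq//; exact: lshift_inj.
- by move=> _ /mapP[i _ ->]; exact: lshift_lt.
- by move=> c _ r; rewrite inE.
- by move=> c _ r; rewrite inE.
- by rewrite -map_comp.
rewrite size_map /survivors => <-.
rewrite -[leqRHS]card_ord; apply: (@card_ranking_unmatched R block rank _ _ ucs) => c ccs r.
rewrite /ranking foldl_cat; apply: ranking_private; [exact: csm|exact: csM].
Qed.

End BlockRanking.
End Block.

(** * The ratio on the bad instance *)

(** The integral of a nonnegative function is a supremum over simple functions below it, hence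
    monotone for arbitrary such functions. It is applied to the matching size, whose measurability
    in the ranks is never established. *)
Lemma nonneg_le_integral d (T : measurableType d) (R : realType)
    (mu : {measure set T -> \bar R}) (f g : T -> \bar R) :
  (forall x, 0 <= f x)%E -> (forall x, f x <= g x)%E ->
  (\int[mu]_x f x <= \int[mu]_x g x)%E.
Proof.
move=> f0 fg; have g0 x : (0 <= g x)%E by apply: le_trans (f0 x) (fg x).
rewrite !ge0_integralTE//; apply: le_ereal_sup => _ [h hf <-].
by exists h => // x; exact: le_trans (hf x) (fg x).
Qed.

Section BlockRatio.
Context (R : realType).
Notation RT := (measurableTypeR R).
Notation unif := (uniform_prob (@ltr01 R)).

Lemma seq_measurable_take d (T : measurableType d) m n (f : T -> seq R) :
  seq_measurable (m + n) f -> seq_measurable m (fun w => take m (f w)).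
Proof.
move=> [sf mf]; split=> [w|i]; first by rewrite size_takel// sf leq_addr.
have [lt_im|le_mi] := ltnP i m.
  rewrite (_ : (fun _ => _) = (fun w => nth 0 (f w) i)) //.
  by apply/funext => w; rewrite nth_take.
rewrite (_ : (fun _ => _) = cst 0); first exact: measurable_cst.
by apply/funext => w; rewrite nth_default// size_takel// sf leq_addr.
Qed.

Lemma seq_measurable_drop d (T : measurableType d) m n (f : T -> seq R) :
  seq_measurable (m + n) f -> seq_measurable n (fun w => drop m (f w)).
Proof.
move=> [sf mf]; split=> [w|i]; first by rewrite size_drop sf addKn.
rewrite (_ : (fun _ => _) = (fun w => nth 0 (f w) (m + i))) //.
by apply/funext => w; rewrite nth_drop.
Qed.

Definition block_survivors m (t : seq R) : nat :=
  survivors (isort (take m t)) (drop m t).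

Lemma tuple_measurable_block_survivors m k :
  tuple_measurable (m + k) (fun t : seq R => (block_survivors m t)%:R%:E).
Proof.
have mt := @seq_measurable_tuple R (m + k).
apply: (measurable_survivors (n := m) (k := k)).
  exact: seq_measurable_isort (seq_measurable_take mt).
exact: seq_measurable_drop mt.
Qed.

Lemma mean_block_survivors_ge m k :
  ((m%:R * (1 - m.+1%:R^-1) ^+ k)%:E <=
   \int[iid unif (m + k)]_t (block_survivors m (tval t))%:R%:E)%E.
Proof.
rewrite (integral_iid_cat _ (@tuple_measurable_block_survivors m k)); last first.
  by move=> s; rewrite lee_fin.
apply: le_trans (mean_survivors_isort_ge R m k) _; rewrite le_eqVlt; apply/orP; left; apply/eqP.
apply: eq_integral => s _; apply: eq_integral => t _.
by rewrite /block_survivors take_size_cat ?size_tuple// drop_size_cat ?size_tuple.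
Qed.

Lemma card_ranking_block m k j (t : seq R) : size t = (m + k)%N ->
  (#|@ranking R (block m k j) (fun s : 'I_(m + k) => nth 0%R t s) (block_arrival m k j)| +
    block_survivors m t <= m + k)%N.
Proof.
move=> st.
have eq_take : [seq nth 0 t (lshift k i) | i <- enum 'I_m] = take m t.
  rewrite -(map_nth_iota0 0) ?st ?leq_addr// -val_enum_ord -map_comp.
  exact: eq_map.
have eq_drop : [seq nth 0 t (rshift m i) | i <- enum 'I_k] = drop m t.
  rewrite -[drop m t]take_size size_drop st addKn -(map_nth_iota 0) ?st ?addKn//.
  by rewrite -[in iota m k](addn0 m) iotaDl -val_enum_ord -!map_comp; exact: eq_map.
rewrite /block_survivors -eq_drop; apply: ranking_block_survivors; first exact: isort_sorted.
by rewrite eq_take perm_sym perm_isort.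
Qed.

Lemma ranking_ALG_block_le m k j :
  (ranking_ALG R (block_instance m k j) <=
   ((m + k)%:R - m%:R * (1 - m.+1%:R^-1) ^+ k)%:E)%E.
Proof.
rewrite /ranking_ALG unlock /=.
pose h (t : seq R) : \bar R :=
  (#|@ranking R (block m k j) (fun s : 'I_(m + k) => nth 0%R t s) (block_arrival m k j)|%:R)%:E.
have -> : (\int[ranks R #|'I_(m + k)|]_t
    (#|@ranking R (block m k j) (fun s : 'I_(m + k) => tnth t (enum_rank s))
       (block_arrival m k j)|%:R)%:E = \int[iid unif (m + k)]_t h (tval t))%E.
  transitivity (\int[iid unif #|'I_(m + k)|]_t h (tval t))%E; last by rewrite card_ord.
  apply: eq_integral => t _; rewrite /h; congr (#|ranking _ _|%:R%:E).
  by apply/funext => s; rewrite (tnth_nth 0) enum_rank_ord.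
pose V (t : seq R) : \bar R := ((m + k)%:R - (block_survivors m t)%:R)%:E.
have bs_le (t : (m + k).-tuple RT) : (block_survivors m (tval t) <= m + k)%N.
  apply: leq_trans (card_ranking_block j (size_tuple t)); exact: leq_addl.
have mS := @tuple_measurable_block_survivors m k.
apply: (@le_trans _ _ (\int[iid unif (m + k)]_t V (tval t))%E).
  apply: nonneg_le_integral => t; first by rewrite lee_fin.
  rewrite lee_fin lerBrDr -natrD ler_nat; exact: card_ranking_block (size_tuple t).
(* Adding the mean of the survivors to both sides replaces a difference of integrals by the integral
   of the constant [m + k]. *)
rewrite EFinB leeBrDr//.
apply: (le_trans (leeD (lexx _) (mean_block_survivors_ge m k))).
rewrite -ge0_integralD//; last 2 first.
- by move=> t _; rewrite lee_fin subr_ge0 ler_nat.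
- apply/measurable_EFinP; apply: measurable_funB => //.
  exact/measurable_EFinP.
rewrite (eq_integral (cst (m + k)%:R%:E)); last first.
  by move=> t _; rewrite /V -EFinD subrK.
rewrite integral_cst// -[leRHS]mule1 lee_wpmul2l//.
exact: probability_le1.
Qed.

End BlockRatio.

Theorem theoremE1 (R : realType) (k d : nat) (hd : (2 <= d)%N) (hk : (d < k)%N) :
  (competitive_ratio (kd_bounded k d) (@ranking_ALG R) <=
   (1 - (1 - d%:R^-1) ^+ k * (d%:R - 1) / (k%:R + d%:R - 1))%:E)%E.
Proof.
case: d hd hk => // m m1 mk.
(* With [k.-1] private requests a safe server has degree exactly [k]; there is at least one of them
   because [k] exceeds 2. *)
have OPT_ge : (m + k <= OPT (block m k k.-1))%N by apply: block_OPT; lia.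
have N0 : (0 < m + k)%N by lia.
apply: (@le_trans _ _ (ranking_ALG R (block_instance m k k.-1) /
    (OPT (block m k k.-1))%:R%:E)%E).
  apply: ereal_inf_lbound; exists (block_instance m k k.-1) => //=; split.
    by apply: block_kd_bounded; lia.
  exact: leq_trans OPT_ge.
have O0 : 0 < (OPT (block m k k.-1))%:R :> R by rewrite ltr0n (leq_trans N0).
set q := (1 - m.+1%:R^-1 : R).
have q01 : 0 <= q <= 1.
  by rewrite subr_ge0 gerBl invr_ge0 ler0n andbT invf_le1 ?ltr0n// ler1n.
have /andP[q0 q1] := q01.
rewrite -natr1 addrK (_ : k%:R + (m%:R + 1) - 1 = (m + k)%:R :> R); last first.
  by rewrite natrD; ring.
have mk0 : 0 < (m + k)%:R :> R by rewrite ltr0n.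
rewrite inver gt_eqF// lee_pdivrMr//.
apply: le_trans (ranking_ALG_block_le R m k k.-1) _; rewrite lee_fin -/q.
rewrite (_ : _ - _ = (1 - q ^+ k * m%:R / (m + k)%:R) * (m + k)%:R); last first.
  by field; rewrite -natrD gt_eqF.
(* [OPT] is only known from below; replacing [m + k] by it is harmless because the claimed ratio is
   nonnegative. *)
rewrite ler_wpM2l ?ler_nat// subr_ge0 ler_pdivrMr// mul1r.
apply: (@le_trans _ _ (1 * m%:R)); last by rewrite mul1r ler_nat leq_addr.
by rewrite ler_wpM2r// exprn_ile1.
Qed.
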